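(* Let $\mathcal{A}$ be a unital C*-algebra (not necessarily commutative), let $a,b\in\overline{\mathbb{D}^*(0,1)}$, and let $p(z)=(z-a)(z-b)\in\mathcal{A}[z]$, with $p'(z)$ defined by $p'(z)=(z-b)+(z-a)$ for all $z\in\mathcal{A}$. Assume that $p'$ admits a root $b_1\in\overline{\mathbb{D}^*(0,1)}$ and that $b_1$ can be written in the form $b_1=\omega_1 a+\omega_2 b$ with $\omega_1,\omega_2\in\mathcal{A}$ positive and $\omega_1+\omega_2=1$. Then there exists a zero $c\in\mathcal{A}$ of $p'$ such that $c\in\overline{\mathbb{D}^*(a,1)}$, and there exists a zero $d\in\mathcal{A}$ of $p'$ such that $d\in\overline{\mathbb{D}^*(b,1)}$.
   Context: $\mathcal{A}[z]$ denotes the set of all polynomials over $\mathcal{A}$. For a unital C*-algebra $\mathcal{A}$ with identity $1$, an element $a\in\mathcal{A}$ and a real number $r>0$, the C*-algebraic closed disc centered at $a$ of radius $r$ is $$\overline{\mathbb{D}^*(a,r)} := \{z\in\mathcal{A} : (z-a)(z-a)^*\leq \sqrt{r}\cdot 1\},$$ where $\leq$ is the usual order on self-adjoint elements of $\mathcal{A}$. For a polynomial $p(z)=(z-a_1)\cdots(z-a_n)\in\mathcal{A}[z]$ over a general unital C*-algebra, the derivative is by definition $p'(z)=\sum_{j=1}^{n}(z-a_1)\cdots\widehat{(z-a_j)}\cdots(z-a_n)$, where the factor under the hat is omitted; for $n=2$ this is the formula given in the claim. ''Positive'' means positive in the C*-algebra sense. *)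

(* Defs.v *)
From HB Require Import structures.
From mathcomp Require Import all_boot all_order all_algebra.
From mathcomp Require Import complex.
From mathcomp Require Import all_classical all_reals all_analysis.

Set Implicit Arguments.
Unset Strict Implicit.
Unset Printing Implicit Defensive.

Import Order.TTheory GRing.Theory Num.Theory.
Import numFieldNormedType.Exports.
Import ComplexField.Normc.

Local Open Scope classical_set_scope.
Local Open Scope complex_scope.
Local Open Scope ring_scope.

(* A unital C*-algebra: a complex *-algebra with a complete submultiplicative
   norm satisfying the C*-identity.  The norm is a field of the mixin because
   Hierarchy-Builder rejects a structure inheriting from both [algType] and
   [completeNormedModType]: [numDomainType] already joins rings with normed
   groups, without an intermediate structure.  As [algType] requires 1 != 0,
   the zero algebra is excluded. *)
HB.mixin Record isCStarAlgebra (R : realType) A & GRing.Algebra R[i] A := {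
  star : A -> A ;
  cnorm : A -> R ;
  starD : forall x y : A, star (x + y) = star x + star y ;
  starZ : forall (k : R[i]) (x : A), star (k *: x) = k^* *: star x ;
  starM : forall x y : A, star (x * y) = star y * star x ;
  starK : forall x : A, star (star x) = x ;
  ler_cnormD : forall x y : A, cnorm (x + y) <= cnorm x + cnorm y ;
  cnormZ : forall (k : R[i]) (x : A), cnorm (k *: x) = normc k * cnorm x ;
  cnorm0_eq0 : forall x : A, cnorm x = 0 -> x = 0 ;
  ler_cnormM : forall x y : A, cnorm (x * y) <= cnorm x * cnorm y ;
  cnorm_starM : forall x : A, cnorm (star x * x) = cnorm x ^+ 2 ;
  cnorm_complete : forall u : nat -> A,
    (forall e : R, 0 < e -> exists N : nat, forall m n : nat,
        (N <= m)%N -> (N <= n)%N -> cnorm (u m - u n) < e) ->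
    exists l : A, cnorm (u n - l) @[n --> \oo] --> (0 : R)
}.

#[short(type="cstarAlgType")]
HB.structure Definition CStarAlgebra (R : realType) :=
  {A of GRing.Algebra R[i] A & isCStarAlgebra R A}.

Section CStarTheory.
Context {R : realType} {A : cstarAlgType R}.
Implicit Types (x y c z : A) (r : R).

Definition selfadjoint x : Prop := star x = x.

Definition invertible x : Prop := exists y, x * y = 1 /\ y * x = 1.

Definition spectrum x : set R[i] := [set l | ~ invertible (x - l *: 1)].

(* In R[i], [0 <= l] means that l is real and nonnegative. *)
Definition cstar_pos x : Prop :=
  selfadjoint x /\ spectrum x `<=` [set l | 0 <= l].

Definition cstar_le x y : Prop :=
  [/\ selfadjoint x, selfadjoint y & cstar_pos (y - x)].

(* The bound is the square root of r, not its square: this disc is the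
   norm ball of radius r `^ (1/4) around c. *)
Definition cstar_closed_disc c r : set A :=
  [set z | cstar_le ((z - c) * star (z - c)) ((Num.sqrt r)%:C *: 1)].

End CStarTheory.

(* Main.v *)
(* A root of p' is the midpoint b1 = (a + b) / 2, and b1 - a = (b - a) / 2, so it
   suffices that a a^* <= 1, a bound on the spectrum of a a^* from above only,
   forces |a| <= 1.  That rests on three facts: a self-adjoint element has real
   spectrum; its norm is its spectral radius (self-adjoint square roots of c - e
   for |e| < c replace the spectral radius formula); and x is positive iff
   |c - x| <= c for some c, so that positive elements form a cone containing the
   squares of self-adjoint elements. *)

Require Import Defs.
From mathcomp Require Import all_boot all_order all_algebra.
From mathcomp Require Import complex.
From mathcomp Require Import all_classical all_reals all_analysis.
From mathcomp Require Import ring lra.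
Import Order.TTheory GRing.Theory Num.Theory.
Import numFieldNormedType.Exports.
Local Open Scope ring_scope.

Set Implicit Arguments.
Unset Strict Implicit.

Section CStarNorm.
Context {R : realType} {A : cstarAlgType R}.
Implicit Types (x y z k : A) (r s t c : R).
Local Notation norm := (@cnorm R A).
Import ComplexField.Normc.
Local Open Scope classical_set_scope.
Local Open Scope complex_scope.
Local Open Scope ring_scope.

(** * Elementary properties of the involution and the norm *)

Lemma normc_real r : normc (r%:C) = `|r|.
Proof. by rewrite /normc /= expr0n /= addr0 sqrtr_sqr. Qed.

Lemma normc_im : normc ('i : R[i]) = 1.
Proof. by rewrite /normc /= expr0n /= add0r expr1n sqrtr1. Qed.

Lemma star0 : star 0 = 0 :> A.
Proof. by apply: (addrI (star 0)); rewrite -starD !addr0. Qed.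

Lemma starN x : star (- x) = - star x.
Proof. by apply: (addrI (star x)); rewrite -starD !addrN star0. Qed.

Lemma starB x y : star (x - y) = star x - star y.
Proof. by rewrite starD starN. Qed.

Lemma star1 : star 1 = 1 :> A.
Proof. by rewrite -[LHS]mulr1 -[X in _ * X](starK 1) -starM mulr1 starK. Qed.

Lemma star_realZ r x : star (r%:C *: x) = r%:C *: star x.
Proof.
rewrite starZ; congr (_ *: _).
by apply/eqP; rewrite eq_complex /= oppr0 !eqxx.
Qed.

Lemma star_imZ x : star ('i *: x) = - ('i *: star x).
Proof.
rewrite starZ -scaleNr; congr (_ *: _).
by apply/eqP; rewrite eq_complex /= oppr0 !eqxx.
Qed.

Lemma cnorm0 : norm 0 = 0.
Proof. by rewrite -(scale0r (0 : A)) cnormZ (normc_real 0) normr0 mul0r. Qed.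

Lemma cnorm_realZ r x : norm (r%:C *: x) = `|r| * norm x.
Proof. by rewrite cnormZ normc_real. Qed.

Lemma cnormN x : norm (- x) = norm x.
Proof.
have -> : - x = (- 1 : R)%:C *: x.
  rewrite -scaleN1r; congr (_ *: _).
  by apply/eqP; rewrite eq_complex /= oppr0 !eqxx.
by rewrite cnorm_realZ normrN1 mul1r.
Qed.

Lemma cnorm_ge0 x : 0 <= norm x.
Proof.
have := ler_cnormD x (- x).
by rewrite addrN cnorm0 cnormN; lra.
Qed.

Lemma ler_cnormB x y : norm (x - y) <= norm x + norm y.
Proof. by rewrite -(cnormN y) ler_cnormD. Qed.

(** The C*-identity gives [|y| ^ 2 <= |star y| |y|]; cancelling [|y|] and applying the result to
    both [x] and [star x] yields equality. *)
Lemma cnorm_star x : norm (star x) = norm x.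
Proof.
have le y : norm y <= norm (star y).
  have [->|n0] := eqVneq (norm y) 0; first exact: cnorm_ge0.
  have y0 : 0 < norm y by rewrite lt_neqAle eq_sym n0 cnorm_ge0.
  by rewrite -(ler_pM2r y0) -expr2 -cnorm_starM ler_cnormM.
by apply/eqP; rewrite eq_le {1}(le x) -{2}(starK x) le.
Qed.

Lemma cnorm_mul_star x : norm (x * star x) = norm x ^+ 2.
Proof. by rewrite -{1}(starK x) cnorm_starM cnorm_star. Qed.

Lemma cnorm1 : norm 1 = 1.
Proof.
have n0 : norm 1 != 0.
  by apply/eqP => /cnorm0_eq0 /eqP; rewrite oner_eq0.
apply: (mulIf n0); rewrite mul1r -expr2 -cnorm_starM star1 mulr1 //.
Qed.

Lemma cnorm_sqr_selfadjoint x : selfadjoint x -> norm (x * x) = norm x ^+ 2.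
Proof. by move=> sx; rewrite -cnorm_starM sx. Qed.

(** * Fixed points of contractions and inversion near the identity *)

(** Banach's fixed point theorem on a closed invariant set [P]. Keeping [P] arbitrary lets the fixed
    point inherit self-adjointness, commutation relations and norm bounds from the iterates. *)
Lemma contraction_fixpoint (P : A -> Prop) (f : A -> A) (q : R) x0 :
  0 <= q < 1 -> P x0 -> (forall x, P x -> P (f x)) ->
  (forall x y, P x -> P y -> norm (f x - f y) <= q * norm (x - y)) ->
  (forall l, (forall e, 0 < e -> exists2 x, P x & norm (x - l) < e) -> P l) ->
  exists2 l, P l & f l = l.
Proof.
move=> /andP[q0 q1] Px0 Pf fq Pcl.
pose u n := iter n f x0.
have Pu n : P (u n) by elim: n => //= n; exact: Pf.
pose D := norm (u 1%N - u 0%N).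
have D0 : 0 <= D by exact: cnorm_ge0.
have step n : norm (u n.+1 - u n) <= q ^+ n * D.
  elim: n => [|n IHn]; first by rewrite expr0 mul1r.
  apply: le_trans (fq (u n.+1) (u n) (Pu _) (Pu _)) _.
  by rewrite exprS -mulrA ler_wpM2l.
(* The geometric sum is kept multiplied by [1 - q], which avoids division in the induction. *)
have dist n m : (1 - q) * norm (u (m + n)%N - u n) <= q ^+ n * D * (1 - q ^+ m).
  elim: m => [|m IHm]; first by rewrite add0n subrr cnorm0 expr0 subrr !mulr0.
  have : norm (u (m.+1 + n)%N - u n) <=
         q ^+ (m + n) * D + norm (u (m + n)%N - u n).
    have -> : u (m.+1 + n)%N - u n
        = (u (m + n).+1 - u (m + n)%N) + (u (m + n)%N - u n).
      by rewrite addrA subrK.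
    by apply: le_trans (ler_cnormD _ _) _; rewrite lerD2r step.
  move=> /(ler_wpM2l (_ : 0 <= 1 - q)) H.
  apply: le_trans (H _) _; first lra.
  by rewrite mulrDr; move: IHm; rewrite exprD exprS; lra.
have distle n m : (1 - q) * norm (u (m + n)%N - u n) <= q ^+ n * D.
  apply: le_trans (dist n m) _.
  have q0n : 0 <= q ^+ n * D by rewrite mulr_ge0 // exprn_ge0.
  by rewrite ler_piMr // gerBl exprn_ge0.
have small e : 0 < e -> exists N, forall n, (N <= n)%N -> q ^+ n * D < e.
  move=> e0.
  have nq : `|q| < 1 by rewrite ger0_norm.
  (* [D + 1] replaces [D] as divisor because [D] may vanish. *)
  have /cvgrPdist_lt /(_ (e / (D + 1))) := cvg_expr nq.
  have D1 : 0 < D + 1 by lra.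
  rewrite divr_gt0 // => /(_ isT) [N _ HN]; exists N => n Nn.
  have := HN n Nn; rewrite /= sub0r normrN ger0_norm ?exprn_ge0 // ltr_pdivlMr //.
  have : 0 <= q ^+ n by rewrite exprn_ge0.
  by lra.
have [l ul] : exists l, cnorm (u n - l) @[n --> \oo] --> (0 : R).
  apply: cnorm_complete => e e0.
  have [|N HN] := small (e / 2 * (1 - q)).
    by rewrite mulr_gt0 //; lra.
  have close n : (N <= n)%N -> norm (u n - u N) < e / 2.
    move=> Nn; have := le_lt_trans (distle N (n - N)%N) (HN N (leqnn N)).
    by rewrite subnK // mulrC ltr_pM2r //; lra.
  exists N => m n Nm Nn.
  have -> : u m - u n = (u m - u N) - (u n - u N) by rewrite opprB addrA subrK.
  have := ler_cnormB (u m - u N) (u n - u N).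
  by have := close m Nm; have := close n Nn; lra.
have near e : 0 < e -> exists N, forall n, (N <= n)%N -> norm (u n - l) < e.
  move=> e0; have /cvgrPdist_lt /(_ e e0) [N _ HN] := ul.
  by exists N => n /HN /=; rewrite sub0r normrN ger0_norm ?cnorm_ge0.
have Pl : P l.
  apply: Pcl => e /near[N HN]; exists (u N); [exact: Pu | exact: HN].
exists l => //; apply/eqP; rewrite -subr_eq0; apply/eqP/cnorm0_eq0.
apply/eqP; rewrite eq_le cnorm_ge0 andbT; apply/ler_addgt0Pr => e e0.
have [|N HN] := near (e / 2); first lra.
have -> : f l - l = (u N.+1 - l) - (u N.+1 - f l).
  by rewrite opprB [RHS]addrC addrA subrK.
apply: le_trans (ler_cnormB _ _) _; rewrite add0r.
have := fq _ _ (Pu N) Pl; have := HN _ (leqnn N); have := HN _ (leqnSn N).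
have : q * norm (u N - l) <= norm (u N - l) by rewrite ler_piMl ?cnorm_ge0 ?ltW.
by move=> /=; lra.
Qed.

(** The fixed points of [y |-> 1 + x y] and [y |-> 1 + y x] are a right and a left inverse, hence
    coincide; no series is summed. *)
Lemma invertible_1B x : norm x < 1 -> invertible (1 - x).
Proof.
move=> x1.
have q01 : 0 <= norm x < 1 by rewrite cnorm_ge0.
have [|y _ /= ey] := @contraction_fixpoint (fun=> True) (fun y => 1 + x * y) _ 0
    q01 I (fun _ _ => I) _ (fun _ _ => I).
  move=> y z _ _; rewrite opprD addrACA subrr add0r -mulrBr; exact: ler_cnormM.
have [|z _ /= ez] := @contraction_fixpoint (fun=> True) (fun y => 1 + y * x) _ 0
    q01 I (fun _ _ => I) _ (fun _ _ => I).
  move=> u v _ _; rewrite opprD addrACA subrr add0r -mulrBl mulrC.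
  exact: ler_cnormM.
have y1 : (1 - x) * y = 1 by rewrite mulrBl mul1r -{1}ey addrK.
have z1 : z * (1 - x) = 1 by rewrite mulrBr mulr1 -{1}ez addrK.
have yz : y = z by rewrite -[z]mulr1 -y1 mulrA z1 mul1r.
by exists y; rewrite {2}yz.
Qed.

Lemma cnorm_small x : (forall e, 0 < e -> norm x <= e) -> x = 0.
Proof.
move=> xe; apply: cnorm0_eq0; apply/eqP; rewrite eq_le cnorm_ge0 andbT.
by apply/ler_addgt0Pr => e /xe; rewrite add0r.
Qed.

(** * Real scalars and self-adjoint elements *)

Definition rscal r : A := r%:C *: 1.

Lemma rscal1 : rscal 1 = 1. Proof. exact: scale1r. Qed.
Lemma rscalD r s : rscal (r + s) = rscal r + rscal s.
Proof. by rewrite /rscal rmorphD scalerDl. Qed.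
Lemma rscalN r : rscal (- r) = - rscal r.
Proof. by rewrite /rscal rmorphN scaleNr. Qed.
Lemma rscalB r s : rscal (r - s) = rscal r - rscal s.
Proof. by rewrite rscalD rscalN. Qed.
Lemma rscal_mul r x : rscal r * x = r%:C *: x.
Proof. by rewrite /rscal -scalerAl mul1r. Qed.
Lemma mul_rscal r x : x * rscal r = r%:C *: x.
Proof. by rewrite /rscal -scalerAr mulr1. Qed.
Lemma rscalM r s : rscal (r * s) = rscal r * rscal s.
Proof. by rewrite rscal_mul /rscal scalerA rmorphM. Qed.
Lemma rscal_comm r x : GRing.comm (rscal r) x.
Proof. by rewrite /GRing.comm rscal_mul mul_rscal. Qed.
Lemma cnorm_rscal r : norm (rscal r) = `|r|.
Proof. by rewrite cnorm_realZ cnorm1 mulr1. Qed.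
Lemma cnorm_rscalM r x : norm (rscal r * x) = `|r| * norm x.
Proof. by rewrite rscal_mul cnorm_realZ. Qed.

Lemma selfadjoint_rscal r : selfadjoint (rscal r).
Proof. by rewrite /selfadjoint star_realZ star1. Qed.
Lemma selfadjointD x y : selfadjoint x -> selfadjoint y -> selfadjoint (x + y).
Proof. by rewrite /selfadjoint starD => -> ->. Qed.
Lemma selfadjointN x : selfadjoint x -> selfadjoint (- x).
Proof. by rewrite /selfadjoint starN => ->. Qed.
Lemma selfadjointB x y : selfadjoint x -> selfadjoint y -> selfadjoint (x - y).
Proof. by move=> ? /selfadjointN; exact: selfadjointD. Qed.
Lemma selfadjointM x y : selfadjoint x -> selfadjoint y -> GRing.comm x y ->
  selfadjoint (x * y).
Proof. by rewrite /selfadjoint starM => -> -> ->. Qed.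
Lemma selfadjoint_sqr x : selfadjoint x -> selfadjoint (x * x).
Proof. by move=> sx; exact: selfadjointM. Qed.
Lemma selfadjoint_mul_star x : selfadjoint (x * star x).
Proof. by rewrite /selfadjoint starM starK. Qed.
Lemma selfadjoint_star_mul x : selfadjoint (star x * x).
Proof. by rewrite /selfadjoint starM starK. Qed.

(** * Self-adjoint square roots *)

(** With [q = 1 - l], the equation [q ^ 2 = 1 - e] becomes [l = (e + l ^ 2) / 2], whose right side
    contracts the ball of radius [|e|] with ratio [|e|]. Commutation with the whole commutant of [e]
    passes to the limit and stands in for functional calculus. *)
Lemma sqrt_1B e : selfadjoint e -> norm e < 1 ->
  exists q, [/\ selfadjoint q, forall z, GRing.comm z e -> GRing.comm z q
    & q * q = 1 - e].
Proof.
move=> se e1.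
pose P y := [/\ selfadjoint y, forall z, GRing.comm z e -> GRing.comm z y
  & norm y <= norm e].
pose f y := rscal (2^-1) * (e + y * y).
have h2 : `|2^-1| = 2^-1 :> R by rewrite ger0_norm // invr_ge0.
have [|||||l [sl cl _] fl] := @contraction_fixpoint P f (norm e) 0.
- by rewrite cnorm_ge0.
- split; first exact: star0.
  + by move=> z _; exact: commr0.
  + by rewrite cnorm0 cnorm_ge0.
- move=> y [sy cy ny]; split.
  + apply: selfadjointM; last exact: rscal_comm.
    * exact: selfadjoint_rscal.
    * exact: selfadjointD se (selfadjoint_sqr sy).
  + move=> z ze; apply: commrM; first exact/commr_sym/rscal_comm.
    by apply: commrD => //; apply: commrM; exact: cy.
  + rewrite cnorm_rscalM h2.
    have := ler_cnormD e (y * y); rewrite cnorm_sqr_selfadjoint //.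
    have : norm y ^+ 2 <= norm e.
      rewrite expr2 -[leRHS]mulr1; apply: ler_pM; rewrite ?cnorm_ge0 //; lra.
    by lra.
- move=> y z [_ _ ny] [_ _ nz].
  rewrite -mulrBr opprD addrACA subrr add0r cnorm_rscalM h2.
  have -> : y * y - z * z = y * (y - z) + (y - z) * z.
    by rewrite mulrBr mulrBl addrA subrK.
  have := ler_cnormD (y * (y - z)) ((y - z) * z).
  have := ler_cnormM y (y - z); have := ler_cnormM (y - z) z.
  have := ler_wpM2r (cnorm_ge0 (y - z)) ny.
  have := ler_wpM2l (cnorm_ge0 (y - z)) nz.
  by lra.
- move=> l lP; split.
  + apply/eqP; rewrite -subr_eq0; apply/eqP/cnorm_small => d d0.
    have [|y [sy _ _] yl] := lP (d / 2); first lra.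
    have -> : star l - l = (y - l) - star (y - l).
      by rewrite starB sy opprB [RHS]addrC addrA subrK.
    by have := ler_cnormB (y - l) (star (y - l)); rewrite cnorm_star; lra.
  + move=> z ze; apply/eqP; rewrite -subr_eq0; apply/eqP/cnorm_small => d d0.
    (* As [y] commutes with [z], the commutator of [z] and [l] is at most [2 |z| |y - l|]; the [+ 1]
       covers [z = 0]. *)
    have z1 : 0 < 2 * norm z + 1 by have := cnorm_ge0 z; lra.
    have [|y [_ cy _] yl] := lP (d / (2 * norm z + 1)); first by rewrite divr_gt0.
    have -> : z * l - l * z = (y - l) * z - z * (y - l).
      by rewrite mulrBr mulrBl (cy z ze) opprB [RHS]addrC addrA subrK.
    apply: le_trans (ler_cnormB _ _) _.
    have := ler_cnormM (y - l) z; have := ler_cnormM z (y - l).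
    move: yl; rewrite ltr_pdivlMr //.
    by have := cnorm_ge0 (y - l); lra.
  + apply/ler_addgt0Pr => d d0; have [y [_ _ ny] yl] := lP d d0.
    have -> : l = y - (y - l) by rewrite subKr.
    by have := ler_cnormB y (y - l); lra.
exists (1 - l); split.
- by apply: selfadjointB sl; exact: star1.
- by move=> z ze; apply: commrB; [exact: commr1|exact: cl].
- have e2 : l + l = e + l * l.
    by rewrite -{1 2}fl -mulrDl -rscalD -[2^-1]mul1r -splitr rscal1 mul1r.
  rewrite mulrBl mul1r mulrBr mulr1 opprB addrACA -opprD e2 (addrC e).
  by rewrite opprD addrA addrK.
Qed.

Lemma sqrt_rscalB e c : selfadjoint e -> norm e < c ->
  exists q, [/\ selfadjoint q, forall z, GRing.comm z e -> GRing.comm z q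
    & q * q = rscal c - e].
Proof.
move=> se ec; have c0 : 0 < c by exact: le_lt_trans (cnorm_ge0 e) ec.
have [||q [sq cq qq]] := @sqrt_1B (rscal c^-1 * e).
- by apply: selfadjointM se _; [exact: selfadjoint_rscal|exact: rscal_comm].
- by rewrite cnorm_rscalM gtr0_norm ?invr_gt0 // mulrC ltr_pdivrMr // mul1r.
exists (rscal (Num.sqrt c) * q); split.
- by apply: selfadjointM sq _; [exact: selfadjoint_rscal|exact: rscal_comm].
- move=> z ze; apply: commrM; first exact/commr_sym/rscal_comm.
  apply: cq; apply: commrM => //; exact/commr_sym/rscal_comm.
- rewrite mulrA -(mulrA (rscal _)) -(rscal_comm _ q) mulrA -rscalM -mulrA qq.
  rewrite -expr2 sqr_sqrtr ?ltW // mulrBr mulr1 mulrA -rscalM divff ?gt_eqF //.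
  by rewrite rscal1 mul1r.
Qed.

(** * Norm and spectral radius of self-adjoint elements *)

Lemma star_mul_cart x y : selfadjoint x -> selfadjoint y -> GRing.comm x y ->
  star (x + 'i *: y) * (x + 'i *: y) = x * x + y * y.
Proof.
move=> sx sy xy; rewrite starD star_imZ sx sy mulrBl !mulrDr.
rewrite -!scalerAl -!scalerAr -xy scalerA -(expr2 (Num.imaginary : R[i])) sqrCi.
by rewrite scaleN1r opprD opprK addrA addrK.
Qed.

(* For commuting self-adjoint [x] and [y], [x] is the real part of the normal
   element [x + 'i y], whose squared modulus is [x ^ 2 + y ^ 2]. *)
Lemma cnorm_sqrD x y : selfadjoint x -> selfadjoint y -> GRing.comm x y ->
  norm x ^+ 2 <= norm (x * x + y * y).
Proof.
move=> sx sy xy; rewrite -star_mul_cart //; set w := x + _.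
have sw : star w = x - 'i *: y by rewrite starD star_imZ sx sy.
rewrite cnorm_starM ler_sqr ?nnegrE ?cnorm_ge0 //.
have : norm (w + star w) <= norm w + norm w.
  by rewrite -{2}(cnorm_star w) ler_cnormD.
have -> : w + star w = rscal 2 * x.
  by rewrite sw addrACA subrr addr0 (rscalD 1 1) mulrDl rscal1 mul1r.
by rewrite cnorm_rscalM ger0_norm //; lra.
Qed.

Lemma invertibleN x : invertible x -> invertible (- x).
Proof. by move=> [y [xy yx]]; exists (- y); rewrite !mulrNN. Qed.

Lemma invertibleZ (l : R[i]) x : l != 0 -> invertible x -> invertible (l *: x).
Proof.
move=> l0 [y [xy yx]]; exists (l^-1 *: y).
by rewrite -!scalerAl -!scalerAr !scalerA xy yx divff // mulVf // scale1r.
Qed.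

Lemma comm_inverse x y z : x * y = 1 -> y * x = 1 -> GRing.comm z x ->
  GRing.comm z y.
Proof.
move=> xy yx zx; rewrite /GRing.comm.
by rewrite -[z in LHS]mul1r -yx -(mulrA y) -zx -!mulrA xy mulr1.
Qed.

(* If [m = |k| > s], then [e = m ^ 2 - k ^ 2] has an inverse [g].  With
   [q ^ 2 = e + h], [r ^ 2 = 1 + h g] and [r' ^ 2 = 1 - d g], where [0 < h << d],
   the identity [(k r) ^ 2 + (q r') ^ 2 = (m ^ 2 - d) r ^ 2] bounds [|k r| ^ 2]
   by about [m ^ 2 - d], although it is within [O(h)] of [m ^ 2]. *)
Lemma cnorm_le_resolvent k s : selfadjoint k -> 0 <= s ->
  (forall t, s < `|t| -> invertible (k - rscal t)) -> norm k <= s.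
Proof.
move=> sk s0 resk; rewrite leNgt; apply/negP.
set m := norm k => sm.
have m0 : 0 < m by lra.
have m20 : 0 < m ^+ 2 by rewrite exprn_gt0.
have [y [y1 y2]] := resk m ltac:(by rewrite gtr0_norm).
have [z [z1 z2]] := resk (- m) ltac:(by rewrite normrN gtr0_norm).
pose e := rscal (m ^+ 2) - k * k.
have se : selfadjoint e.
  by apply: selfadjointB; [exact: selfadjoint_rscal|exact: selfadjoint_sqr].
(* Both [k - m] and [k + m] are invertible because [m > s], so their inverses multiply, up to sign,
   to an inverse of [e]. *)
have ee : e = - ((k - rscal m) * (k - rscal (- m))).
  rewrite rscalN opprK mulrBl !mulrDr -rscal_comm -rscalM -expr2 opprB /e.
  by rewrite (addrC (k * k)) opprD addrACA subrr add0r.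
pose g := - (z * y).
have eg : e * g = 1.
  by rewrite ee /g mulrNN mulrA -(mulrA (k - _)) z1 mulr1.
have ge : g * e = 1.
  by rewrite ee /g mulrNN mulrA -(mulrA z) y2 mulr1.
have sg : selfadjoint g.
  rewrite /selfadjoint -[LHS]mulr1 -eg mulrA -se -starM eg star1.
  by rewrite mul1r.
have kk : GRing.comm k (k * k) by apply: commrM.
have ke : GRing.comm k e by apply: commrB kk; exact/commr_sym/rscal_comm.
have kg : GRing.comm k g by exact: comm_inverse eg ge ke.
pose G := norm g.
have G0 : 0 <= G by exact: cnorm_ge0.
have mG0 : 0 <= m ^+ 2 * G by rewrite mulr_ge0 // ltW.
(* Chosen so that [2 d (1 + m ^ 2 G) = m ^ 2], which forces [d < m ^ 2] and [d G < 1]; the latter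
   allows a root of [1 - d g]. *)
pose d := m ^+ 2 / (2 * (1 + m ^+ 2 * G)).
have d0 : 0 < d by rewrite divr_gt0 //; lra.
have dE : 2 * d + 2 * (d * (m ^+ 2 * G)) = m ^+ 2.
  by rewrite /d; field; lra.
have dm : d < m ^+ 2.
  have : 0 <= d * (m ^+ 2 * G) by rewrite mulr_ge0 // ltW.
  by lra.
have dG : d * G < 1.
  rewrite -(ltr_pM2r m20) mul1r -mulrA (mulrC G); lra.
(* Chosen so that [4 h m ^ 2 (G + 1) = d]: the errors of order [h m ^ 2 G] then stay below [d]. *)
pose h := d / (4 * (m ^+ 2 * (G + 1))).
have mG1 : 0 < m ^+ 2 * (G + 1) by rewrite mulr_gt0 //; lra.
have h0 : 0 < h by rewrite divr_gt0 //; lra.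
have hE : 4 * (h * m ^+ 2 * G) + 4 * (h * m ^+ 2) = d.
  by rewrite /h; field; rewrite ?gt_eqF //; lra.
have hm0 : 0 < h * m ^+ 2 by rewrite mulr_gt0.
have hmG0 : 0 <= h * m ^+ 2 * G by rewrite mulr_ge0 // ltW.
have hG : h * G < 1.
  rewrite -(ltr_pM2r m20) mul1r -mulrA (mulrC G) mulrA; lra.
have sqr_k : norm (k * k) = m ^+ 2 by exact: cnorm_sqr_selfadjoint.
have [||r [sr cr rr]] := @sqrt_rscalB (rscal (- h) * g) 1.
- by apply: selfadjointM sg _; [exact: selfadjoint_rscal|exact: rscal_comm].
- by rewrite cnorm_rscalM normrN gtr0_norm.
have [||r' [sr' cr' rr']] := @sqrt_rscalB (rscal d * g) 1.
- by apply: selfadjointM sg _; [exact: selfadjoint_rscal|exact: rscal_comm].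
- by rewrite cnorm_rscalM gtr0_norm.
(* The shift by [h] is what makes [|k ^ 2| = m ^ 2] strictly smaller than the scalar, as the square
   root requires. *)
have [||q [sq cq qq]] := @sqrt_rscalB (k * k) (m ^+ 2 + h).
- exact: selfadjoint_sqr.
- by rewrite sqr_k; lra.
have comm_r v : GRing.comm v g -> GRing.comm v r.
  by move=> vg; apply: cr; apply: commrM vg; exact/commr_sym/rscal_comm.
have comm_r' v : GRing.comm v g -> GRing.comm v r'.
  by move=> vg; apply: cr'; apply: commrM vg; exact/commr_sym/rscal_comm.
have kq : GRing.comm k q by exact: cq.
have qg : GRing.comm q g.
  by apply: commr_sym; apply: cq; apply: commrM; exact: commr_sym.
have kr := comm_r _ kg; have kr' := comm_r' _ kg.
have qr := comm_r _ qg; have qr' := comm_r' _ qg.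
have r'r : GRing.comm r' r.
  by apply: comm_r; apply: commr_sym; exact: comm_r'.
have := @cnorm_sqrD (k * r) (q * r')
  (selfadjointM sk sr kr) (selfadjointM sq sr' qr') _.
have krr : (k * r) * (k * r) = k * k * (r * r).
  by rewrite mulrA -(mulrA k r) -kr !mulrA.
have qrr : (q * r') * (q * r') = q * q * (r' * r').
  by rewrite mulrA -(mulrA q r') -qr' !mulrA.
have comm_krqr : GRing.comm (k * r) (q * r').
  by apply: commr_sym; apply: commrM; apply/commr_sym/commrM => //;
    exact: commr_sym.
move=> /(_ comm_krqr); rewrite -cnorm_sqr_selfadjoint; last exact: selfadjointM.
rewrite krr qrr.
have rrE : r * r = 1 + rscal h * g by rewrite rr rscal1 rscalN mulNr opprK.
have -> : k * k * (r * r) + q * q * (r' * r') = rscal (m ^+ 2 - d) * (r * r).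
  have -> : k * k = rscal (m ^+ 2) - e by rewrite /e subKr.
  have -> : q * q = rscal h + e by rewrite qq /e rscalD addrAC [RHS]addrC.
  have -> : r' * r' = 1 - rscal d * g by rewrite rr' rscal1.
  rewrite rrE mulrBl mulrBr mulr1.
  have -> : e * (1 + rscal h * g) = rscal h + e.
    by rewrite mulrDr mulr1 mulrA -rscal_comm -mulrA eg mulr1 addrC.
  have -> : (rscal h + e) * (rscal d * g) = rscal d * (1 + rscal h * g).
    rewrite mulrA -rscal_comm -mulrA mulrDl eg addrC //.
  by rewrite addrA subrK rscalB mulrBl.
have : norm (rscal (m ^+ 2 - d) * (r * r)) <= (m ^+ 2 - d) * (1 + h * G).
  rewrite cnorm_rscalM ger0_norm; last lra.
  apply: ler_wpM2l; first lra.
  by rewrite rrE (le_trans (ler_cnormD _ _)) // cnorm1 cnorm_rscalM gtr0_norm.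
have : norm (k * k) - h * (m ^+ 2 * G) <= norm (k * k * (r * r)).
  rewrite lerBlDr.
  have kkE : k * k = k * k * (r * r) - rscal h * (k * k * g).
    by rewrite rrE mulrDr mulr1 mulrA -rscal_comm -(mulrA (rscal h)) addrK.
  rewrite {1}kkE (le_trans (ler_cnormB _ _)) // lerD2l cnorm_rscalM gtr0_norm //.
  apply: ler_wpM2l; first exact: ltW.
  by rewrite -sqr_k ler_cnormM.
(* The bounds give [m ^ 2 - h m ^ 2 G <= (m ^ 2 - d) (1 + h G)], hence [d <= 2 h m ^ 2 G], against
   the choice of [h]. *)
rewrite sqr_k.
have : 0 <= d * (h * G) 
  by apply: mulr_ge0; [exact: ltW|apply: mulr_ge0 => //; exact: ltW].
by lra.
Qed.

(** * Location of the spectrum *)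

Lemma invertible_cnorm_lt x (l : R[i]) : norm x < normc l ->
  invertible (x - l *: 1).
Proof.
move=> xl.
have l0 : l != 0.
  apply/eqP => l0; move: xl; rewrite l0 (normc_real 0) normr0.
  by have := cnorm_ge0 x; lra.
have -> : x - l *: 1 = - (l *: (1 - l^-1 *: x)).
  by rewrite scalerBr scalerA divff // scale1r opprB.
apply/invertibleN/invertibleZ => //; apply: invertible_1B.
have lp : 0 < normc l by apply: le_lt_trans xl; exact: cnorm_ge0.
by rewrite -(ltr_pM2l lp) -cnormZ scalerA divff // scale1r mulr1.
Qed.

(** Shifting [x] and [l = p + i b] by the same [i t] leaves [x - l] unchanged, but
    [|x + i t| ^ 2 <= |x| ^ 2 + t ^ 2] while [|l + i t| ^ 2 = p ^ 2 + (b + t) ^ 2], so a suitable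
    [t] puts [l + i t] outside the norm disc. *)
Lemma invertible_selfadjoint_Im x (l : R[i]) : selfadjoint x ->
  complex.Im l != 0 -> invertible (x - l *: 1).
Proof.
move=> sx l0; case: l l0 => p b /= b0.
(* Here [2 b t = |x| ^ 2], so the second quantity exceeds the first bound by [p ^ 2 + b ^ 2 > 0]. *)
pose t := norm x ^+ 2 / (2 * b).
have -> : x - (p +i* b) *: 1
   = (x + 'i *: rscal t) - ((p +i* b) + 'i * t%:C) *: 1.
  by rewrite scalerDl scalerA opprD addrACA subrr addr0.
apply: invertible_cnorm_lt.
rewrite -ltr_sqr ?nnegrE ?cnorm_ge0 //; last by rewrite /normc sqrtr_ge0.
have -> : normc (p +i* b + 'i * t%:C) ^+ 2 = p ^+ 2 + (b + t) ^+ 2.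
  rewrite -complexiE /normc /= !(mul0r, mulr0, mul1r, mulr1, addr0, add0r, subr0).
  by rewrite sqr_sqrtr // addr_ge0 // sqr_ge0.
rewrite -cnorm_starM star_mul_cart //;
  [|exact: selfadjoint_rscal|exact/commr_sym/rscal_comm].
apply: le_lt_trans (ler_cnormD _ _) _.
rewrite cnorm_sqr_selfadjoint // -rscalM cnorm_rscal -expr2 ger0_norm ?sqr_ge0 //.
have bt : 2 * b * t = norm x ^+ 2 by rewrite /t; field.
have : 0 < b ^+ 2 by rewrite exprn_even_gt0.
have := sqr_ge0 p.
by rewrite -bt; nra.
Qed.

Lemma invertible_rscal_lt x r : norm x < `|r| -> invertible (x - rscal r).
Proof. by move=> xr; apply: invertible_cnorm_lt; rewrite normc_real. Qed.

(** * The cone of positive elements *)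

(** The spectrum being real, only the negative scalars [- t] remain to be excluded. *)
Lemma cstar_posI x : selfadjoint x ->
  (forall t, 0 < t -> invertible (x + rscal t)) -> cstar_pos x.
Proof.
move=> sx xt; split=> // l /= nl.
have im0 : complex.Im l = 0.
  apply/eqP; apply/negP => /negP im.
  by apply: nl; exact: invertible_selfadjoint_Im.
have lE : l = (complex.Re l)%:C.
  by apply/eqP; rewrite eq_complex /= im0 !eqxx.
rewrite lE ler0c leNgt; apply/negP => l0; apply: nl.
by rewrite lE -/(rscal _) -rscalN; apply: xt; rewrite oppr_gt0.
Qed.

Lemma cstar_pos_invertible x t : cstar_pos x -> 0 < t ->
  invertible (x + rscal t).
Proof.
move=> [_ posx] t0; apply: contrapT => nx.
have := posx ((- t)%:C); rewrite /= /spectrum /= -/(rscal _) rscalN opprK.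
by move=> /(_ nx); rewrite ler0c; lra.
Qed.

Lemma cstar_pos_of_cnorm x c : selfadjoint x -> norm (rscal c - x) <= c ->
  cstar_pos x.
Proof.
move=> sx xc; apply: cstar_posI => // t t0.
have -> : x + rscal t = - ((rscal c - x) - rscal (c + t)).
  by rewrite rscalD !opprB [RHS]addrC addrA subrK.
have c0 : 0 <= c := le_trans (cnorm_ge0 _) xc.
by apply/invertibleN/invertible_rscal_lt; rewrite ger0_norm; lra.
Qed.

(** Converse of the norm criterion, with [c = |x|]. The spectral radius bound applies to [|x| - x]:
    positivity of [x] handles scalars [t > |x|], and the norm of [x] handles [t < - |x|]. *)
Lemma cnorm_of_cstar_pos x : cstar_pos x ->
  norm (rscal (norm x) - x) <= norm x.
Proof.
move=> px; have [sx _] := px; have n0 := cnorm_ge0 x.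
apply: cnorm_le_resolvent => //.
  by apply: selfadjointB sx; exact: selfadjoint_rscal.
move=> t nt.
have -> : rscal (norm x) - x - rscal t = - (x - rscal (norm x) + rscal t).
  by rewrite opprD opprB.
apply: invertibleN.
have [t0|t0] := ltP 0 t.
  have -> : x - rscal (norm x) + rscal t = x + rscal (t - norm x).
    by rewrite rscalB addrAC -addrA.
  by apply: cstar_pos_invertible => //; move: nt; rewrite gtr0_norm //; lra.
have -> : x - rscal (norm x) + rscal t = x - rscal (norm x - t).
  by rewrite rscalB opprB addrAC -addrA.
by apply: invertible_rscal_lt; move: nt; rewrite ler0_norm // ger0_norm; lra.
Qed.

(** In the norm criterion the constants add up, by the triangle inequality. *)
Lemma cstar_posD x y : cstar_pos x -> cstar_pos y -> cstar_pos (x + y).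
Proof.
move=> px py; apply: (@cstar_pos_of_cnorm _ (norm x + norm y)).
  by apply: selfadjointD; [case: px|case: py].
rewrite rscalD opprD addrACA; apply: le_trans (ler_cnormD _ _) _.
by apply: lerD; exact: cnorm_of_cstar_pos.
Qed.

Lemma cstar_posM r x : 0 <= r -> cstar_pos x -> cstar_pos (rscal r * x).
Proof.
move=> r0 px; apply: (@cstar_pos_of_cnorm _ (r * norm x)).
  by case: px => sx _; apply: selfadjointM sx _;
    [exact: selfadjoint_rscal|exact: rscal_comm].
rewrite rscalM -mulrBr cnorm_rscalM ger0_norm // ler_wpM2l //.
exact: cnorm_of_cstar_pos.
Qed.

Lemma cstar_pos_rscal r : 0 <= r -> cstar_pos (rscal r : A).
Proof.
move=> r0; apply: (@cstar_pos_of_cnorm _ r); first exact: selfadjoint_rscal.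
by rewrite subrr cnorm0.
Qed.

(** For [c = |x ^ 2| + 1] and [q ^ 2 = c - x ^ 2], [cnorm_sqrD] gives
    [|q| ^ 2 <= |q ^ 2 + x ^ 2| = c], which is the norm criterion for [x ^ 2]. *)
Lemma cstar_pos_sqr x : selfadjoint x -> cstar_pos (x * x).
Proof.
move=> sx; have sxx := selfadjoint_sqr sx.
have [||q [sq cq qq]] := @sqrt_rscalB (x * x) (norm (x * x) + 1) => //.
  by lra.
apply: (@cstar_pos_of_cnorm _ (norm (x * x) + 1)) => //.
rewrite -qq cnorm_sqr_selfadjoint //.
have qx : GRing.comm q x by apply/commr_sym/cq/commrM.
apply: le_trans (cnorm_sqrD sq sx qx) _.
by rewrite qq subrK cnorm_rscal ger0_norm // addr_ge0 // cnorm_ge0.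
Qed.

(** * From order bounds to norm bounds *)

Lemma cnorm_le_cstar_pos x c : 0 <= c -> cstar_pos (rscal c - x) ->
  cstar_pos (rscal c + x) -> norm x <= c.
Proof.
move=> c0 px px'.
have sx : selfadjoint x.
  rewrite -(subKr (rscal c) x).
  by apply: selfadjointB; [exact: selfadjoint_rscal|case: px].
apply: cnorm_le_resolvent => // t; have [t0|t0] := ltP 0 t.
  rewrite gtr0_norm // => ct.
  have -> : x - rscal t = - ((rscal c - x) + rscal (t - c)).
    by rewrite rscalB [in RHS]addrC addrA subrK opprB.
  by apply/invertibleN/cstar_pos_invertible => //; lra.
rewrite ler0_norm // => ct.
have -> : x - rscal t = (rscal c + x) + rscal (- t - c).
  by rewrite rscalB rscalN [RHS]addrC addrA subrK addrC.
by apply: cstar_pos_invertible => //; lra.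
Qed.

Lemma cnorm_sqr_le_cstar_pos x c : selfadjoint x -> 0 <= c ->
  cstar_pos (rscal c - x * x) -> norm x ^+ 2 <= c.
Proof.
move=> sx c0 px; rewrite -cnorm_sqr_selfadjoint //.
apply: cnorm_le_cstar_pos => //.
by apply: cstar_posD; [exact: cstar_pos_rscal|exact: cstar_pos_sqr].
Qed.

(** If [z] inverts [c - x y], then [c^-1 (1 + y z x)] inverts [c - y x]. *)
Lemma invertible_rscalB_mulC x y c : c != 0 ->
  invertible (rscal c - x * y) -> invertible (rscal c - y * x).
Proof.
move=> c0 [z [z1 z2]].
have cE v : rscal c^-1 * (rscal c * v) = v.
  by rewrite mulrA -rscalM mulVf // rscal1 mul1r.
exists (rscal c^-1 * (1 + y * z * x)); split.
  rewrite mulrA -rscal_comm -mulrA -[RHS]cE mulr1; congr (_ * _).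
  rewrite mulrDr mulr1 mulrBl.
  have -> : rscal c * (y * z * x) - y * x * (y * z * x)
       = y * ((rscal c - x * y) * z) * x.
    by rewrite !mulrBl mulrBr mulrBl !mulrA (rscal_comm c y).
  by rewrite z1 mulr1 subrK.
rewrite -mulrA -[RHS]cE mulr1; congr (_ * _).
rewrite mulrDl mul1r mulrBr.
have -> : y * z * x * rscal c - y * z * x * (y * x)
     = y * (z * (rscal c - x * y)) * x.
  by rewrite !mulrBr mulrBl -!mulrA (rscal_comm c x).
by rewrite z2 mulr1 subrK.
Qed.

Lemma cstar_pos_star_mulC x c : 0 <= c -> cstar_pos (rscal c - x * star x) ->
  cstar_pos (rscal c - star x * x).
Proof.
move=> c0 px; apply: cstar_posI.
  by apply: selfadjointB; [exact: selfadjoint_rscal|exact: selfadjoint_star_mul].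
move=> t t0; rewrite addrAC -rscalD; apply: invertible_rscalB_mulC.
  by rewrite gt_eqF //; lra.
by rewrite rscalD addrAC; exact: cstar_pos_invertible.
Qed.

(* With [u], [v] twice the real and imaginary parts of [x],
   [u ^ 2 + v ^ 2 = 2 (x x^* + x^* x) <= 4 c], so [u ^ 2 <= 4 c] and
   [v ^ 2 <= 4 c]: an upper bound on the spectrum of [x x^*] alone already
   controls the norm of [x]. *)
Lemma cnorm_le_upper_bound x c : 0 <= c -> cstar_pos (rscal c - x * star x) ->
  norm x ^+ 2 <= 4 * c.
Proof.
move=> c0 px; have px' := cstar_pos_star_mulC c0 px.
pose u := x + star x; pose v := 'i *: (x - star x).
have su : selfadjoint u by rewrite /selfadjoint /u starD starK addrC.
have sv : selfadjoint v.
  by rewrite /selfadjoint /v star_imZ starB starK -scalerN opprB.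
have c4 : 0 <= 4 * c by rewrite mulr_ge0.
have pT : cstar_pos (rscal (4 * c) - (u * u + v * v)).
  have -> : rscal (4 * c) - (u * u + v * v)
     = rscal 2 * ((rscal c - x * star x) + (rscal c - star x * x)).
    have -> : u * u + v * v = rscal 2 * (x * star x + star x * x).
      have -> : u * u = (x * star x + star x * x) + (x * x + star x * star x).
        by rewrite /u mulrDl !mulrDr (addrC (x * x)) addrACA.
      have -> : v * v = (x * star x + star x * x) - (x * x + star x * star x).
        rewrite /v -scalerAl -scalerAr scalerA -(expr2 (Num.imaginary : R[i])).
        rewrite sqrCi scaleN1r mulrBl !mulrBr !opprB addrACA -opprD.
        by rewrite (addrC (star x * x)) (addrC (star x * star x)).
      by rewrite addrACA subrr addr0 (rscalD 1 1) rscal1 mulrDl mul1r.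
    rewrite addrACA -opprD mulrBr -rscalD -rscalM; congr (rscal _ - _); ring.
  by apply: cstar_posM => //; exact: cstar_posD.
have un : norm u ^+ 2 <= 4 * c.
  apply: cnorm_sqr_le_cstar_pos => //.
  have := cstar_posD pT (cstar_pos_sqr sv).
  by rewrite opprD addrA subrK.
have vn : norm v ^+ 2 <= 4 * c.
  apply: cnorm_sqr_le_cstar_pos => //.
  have := cstar_posD pT (cstar_pos_sqr su).
  by rewrite (addrC (u * u)) opprD addrA subrK.
have : norm (rscal 2 * x) <= norm u + norm v.
  rewrite cnormZ normc_im mul1r.
  have -> : rscal 2 * x = u + (x - star x).
    by rewrite /u addrACA subrr addr0 (rscalD 1 1) rscal1 mulrDl mul1r.
  exact: ler_cnormD.
rewrite cnorm_rscalM ger0_norm //.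
have := cnorm_ge0 x; have := cnorm_ge0 u; have := cnorm_ge0 v.
move: un vn; move: (norm u) (norm v) (norm x) => a b n un vn b0 a0 n0 nab.
(* [4 n ^ 2 <= (a + b) ^ 2 <= 2 (a ^ 2 + b ^ 2) <= 16 c]. *)
have : (2 * n) ^+ 2 <= (a + b) ^+ 2 by rewrite ler_sqr ?nnegrE //; lra.
by have := sqr_ge0 (a - b); nra.
Qed.

(* For [h = x x^*] and [c > 1], [c - h = q ^ 2] and [y = q x] satisfies
   [c ^ 2 / 4 - y y^* = (h - c / 2) ^ 2 >= 0], whence [|y| <= c]; then
   [c (c + h) = c ^ 2 + y y^* + h ^ 2 >= 0] and [-c <= h <= c]. *)
Lemma cnorm_le1_cstar_pos x : cstar_pos (1 - x * star x) -> norm x <= 1.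
Proof.
move=> px; rewrite -ler_sqr ?nnegrE ?cnorm_ge0 // expr1n.
apply/ler_addgt0Pr => d d0; set c := 1 + d.
have c0 : 0 < c by rewrite /c; lra.
rewrite -cnorm_mul_star; set h := x * star x.
have sh : selfadjoint h by exact: selfadjoint_mul_star.
set p := 1 - h in px; have [sp _] := px.
(* [c - h = d + p = (|p| + d) - (|p| - p)], and positivity of [p] bounds [||p| - p|] by
   [|p| < |p| + d]; the slack [d] makes this strict. *)
have [||q [sq cq qq]] := @sqrt_rscalB (rscal (norm p) - p) (norm p + d).
- by apply: selfadjointB sp; exact: selfadjoint_rscal.
- by have := cnorm_of_cstar_pos px; lra.
have qqE : q * q = rscal c - h.
  by rewrite qq rscalD addrC opprB addrA subrK /p /c rscalD rscal1 addrAC.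
have hq : GRing.comm h q.
  apply: cq; apply: commrB; first exact/commr_sym/rscal_comm.
  by apply: commrB => //; exact: commr1.
pose y := q * x.
have yy : y * star y = rscal c * h - h * h.
  by rewrite /y starM sq mulrA -(mulrA q) -/h -mulrA hq mulrA qqE mulrBl.
have yn : norm y ^+ 2 <= 4 * (c ^+ 2 / 4).
  apply: cnorm_le_upper_bound; first by rewrite divr_ge0 ?sqr_ge0.
  have -> : rscal (c ^+ 2 / 4) - y * star y
      = (h - rscal (c / 2)) * (h - rscal (c / 2)).
    have cc : c / 2 * (c / 2) = c ^+ 2 / 4 by field.
    rewrite yy mulrBl !mulrBr -rscalM cc -rscal_comm.
    have -> : rscal c * h = rscal (c / 2) * h + rscal (c / 2) * h.
      by rewrite -mulrDl -rscalD -splitr.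
    by rewrite !opprB opprD !addrA [_ + h * h]addrC (addrAC (h * h) (rscal _)).
  by apply: cstar_pos_sqr; apply: selfadjointB sh _; exact: selfadjoint_rscal.
have pch : cstar_pos (rscal c * (rscal c + h)).
  have -> : rscal c * (rscal c + h) = (rscal (c ^+ 2) + y * star y) + h * h.
    by rewrite yy mulrDr -rscalM expr2 addrA subrK.
  apply: cstar_posD; last exact: cstar_pos_sqr.
  (* Positivity of [y y^*] is not yet available; [|y| ^ 2 <= c ^ 2] suffices for that of
     [c ^ 2 + y y^*]. *)
  apply: (@cstar_pos_of_cnorm _ (c ^+ 2)).
    by apply: selfadjointD; [exact: selfadjoint_rscal|exact: selfadjoint_mul_star].
  by rewrite opprD addrA subrr add0r cnormN cnorm_mul_star; lra.
apply: cnorm_le_cstar_pos; first exact: ltW.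
  by rewrite -qqE; exact: cstar_pos_sqr.
have := cstar_posM (_ : 0 <= c^-1) pch; rewrite mulrA -rscalM mulVf ?gt_eqF //.
by rewrite rscal1 mul1r; apply; rewrite invr_ge0 ltW.
Qed.

(** * Discs of radius 1 and norm balls *)

Lemma disc01_cnorm a : cstar_closed_disc 0 1 a -> norm a <= 1.
Proof.
rewrite /cstar_closed_disc /= subr0 sqrtr1 => -[_ _].
by rewrite -/(rscal 1) rscal1; exact: cnorm_le1_cstar_pos.
Qed.

Lemma cnorm_disc1 a z : norm (z - a) <= 1 -> cstar_closed_disc a 1 z.
Proof.
move=> za; rewrite /cstar_closed_disc /= sqrtr1 -/(rscal 1).
have szz := selfadjoint_mul_star (z - a).
split=> //; first exact: selfadjoint_rscal.
apply: (@cstar_pos_of_cnorm _ 1).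
  by apply: selfadjointB => //; exact: selfadjoint_rscal.
by rewrite subKr cnorm_mul_star exprn_ile1 // cnorm_ge0.
Qed.

End CStarNorm.

Theorem theorem2p6 (R : realType) (A : cstarAlgType R) (a b : A)
    (ha : cstar_closed_disc 0 1 a) (hb : cstar_closed_disc 0 1 b)
    (p p' : A -> A)
    (hp : forall z : A, p z = (z - a) * (z - b))
    (hp' : forall z : A, p' z = (z - b) + (z - a))
    (b1 : A) (hroot : p' b1 = 0) (hb1 : cstar_closed_disc 0 1 b1)
    (w1 w2 : A) (hw1 : cstar_pos w1) (hw2 : cstar_pos w2)
    (hw : w1 + w2 = 1) (hb1w : b1 = w1 * a + w2 * b) :
  (exists c : A, p' c = 0 /\ cstar_closed_disc a 1 c) /\
  (exists d : A, p' d = 0 /\ cstar_closed_disc b 1 d).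
Proof.
have ab : b1 - b = - (b1 - a).
  by apply/eqP; rewrite -addr_eq0 -hp' hroot.
have n1 : cnorm (b1 - a) <= 1.
  have : cnorm (rscal 2 * (b1 - a)) <= cnorm b + cnorm a.
    have -> : rscal 2 * (b1 - a) = b - a.
      rewrite (rscalD 1 1) rscal1 mulrDl mul1r -{1}[b1 - a]opprK -ab opprB.
      by rewrite addrA subrK.
    exact: ler_cnormB.
  rewrite cnorm_rscalM ger0_norm //.
  by have := disc01_cnorm ha; have := disc01_cnorm hb; lra.
(* The same root serves both discs, since [b1 - a] and [b1 - b] are opposite. *)
split; exists b1; split=> //; apply: cnorm_disc1 => //.
by rewrite ab cnormN.
Qed.
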